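(* Let $B\subset A$ be an irreducible unital inclusion of simple unital $C^*$-algebras (that is, $B'\cap A=\mathbb{C}1$) admitting a conditional expectation from $A$ onto $B$ of index-finite type, and let $C,D$ be two intermediate (simple) unital $C^*$-subalgebras, $B\subset C,D\subset A$. Let $\Theta=e_Ce_D\in B'\cap A_1$ be the angle operator, let $\mathcal{F}:B'\cap A_1\to A'\cap A_2$ be the Fourier transform, let $\delta=\sqrt{[A:B]_0}$, and let $H$ denote the von Neumann entropy. Then $$H\big(|\mathcal{F}(\Theta)|^2\big)=\frac{2}{\sqrt{[A:B]_0}}\,\eta\big(\delta\,\mathrm{tr}(e_Ce_D)\big).$$
   Context: All inclusions are unital (common identity). A conditional expectation $E:A\to B$ is of index-finite type if there is a finite quasi-basis $\{\lambda_1,\dots,\lambda_n\}\subset A$, i.e. $x=\sum_i\lambda_iE(\lambda_i^*x)$ for all $x\in A$; then $\mathrm{Ind}_w(E)=\sum_i\lambda_i\lambda_i^*$ (Watatani index, a scalar when $A$ is simple). For simple unital $B\subset A$ with an expectation of index-finite type there is a unique minimal conditional expectation $E^A_B$ (the one of smallest index), and $[A:B]_0:=\mathrm{Ind}_w(E^A_B)=:\delta^2$. Tower: $A_1$ is the $C^*$-basic construction of $B\subset A$ with respect to $E^A_B$, i.e. the algebra of adjointable right $B$-linear maps of the Hilbert $B$-module $A$ (inner product $E^A_B(x^*y)$), generated by $A$ (left multiplication) and the Jones projection $e_1:a\mapsto E^A_B(a)$. Put $A_{-1}=B$, $A_0=A$; iterating gives $B\subset A\subset A_1\subset A_2\subset\cdots$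 of simple unital $C^*$-algebras, with minimal conditional expectations $E^{A_k}_{A_{k-1}}$, and $e_{k+1}\in A_{k+1}$ is the Jones projection of $A_{k-1}\subset A_k$. The relative commutants $B'\cap A_k$ are finite-dimensional, and $\mathrm{tr}:=E^A_B\circ E^{A_1}_A\circ\cdots\circ E^{A_k}_{A_{k-1}}$ restricted to $B'\cap A_k$ is a faithful tracial state (compatible for different $k$). Intermediate algebras: for an intermediate simple unital $C^*$-subalgebra $B\subset C\subset A$ there are minimal conditional expectations $E^A_C$ and $E^C_B=E^A_B|_C$ with $E^A_B=E^C_B\circ E^A_C$. The Jones projection $e_C$ of $E^A_C$ is the map $a\mapsto E^A_C(a)$, viewed as an element of $B'\cap A_1$. Similarly for $D$. Fourier transform: $\mathcal{F}(x)=\delta^3E^{B'\cap A_2}_{A'\cap A_2}(xe_2e_1)$ for $x\in B'\cap A_1$, where $E^{B'\cap A_2}_{A'\cap A_2}(y)=\frac{1}{[A:B]_0}\sum_i\lambda_iy\lambda_i^*$ is the trace-preserving conditional expectation, $\{\lambda_i\}$ being a quasi-basis of $E^A_B$. Entropy: $\eta(t)=-t\log t$ for $t>0$, $\eta(0)=0$. For $x$ in $B'\cap A_1$ or in $A'\cap A_2$, $|x|^2=x^*x$ and $H(|x|^2)=\mathrm{tr}(\eta(|x|^2))$ (functional calculus). *)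

(* Defs.v *)
From HB Require Import structures.
From mathcomp Require Import all_boot all_order all_algebra.
From mathcomp Require Import all_classical all_reals all_analysis.
From mathcomp Require Import complex.

Set Implicit Arguments.
Unset Strict Implicit.
Unset Printing Implicit Defensive.

Import Order.TTheory GRing.Theory Num.Theory numFieldNormedType.Exports.
Local Open Scope classical_set_scope.
Local Open Scope ring_scope.
Local Open Scope complex_scope.

HB.mixin Record Algebra_hasStar (K : numClosedFieldType) A
    of GRing.Algebra K A := {
  star : A -> A;
  starK : involutive star;
  starD : {morph star : x y / x + y};
  starM : forall x y : A, star (x * y) = star y * star x;
  starZ : forall (c : K) (x : A), star (c *: x) = Num.conj c *: star x }.

#[short(type="starAlgType")]
HB.structure Definition StarAlgebra (K : numClosedFieldType) :=
  {A of Algebra_hasStar K A & GRing.Algebra K A}.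

Lemma star0 (K : numClosedFieldType) (A : starAlgType K) : star (0 : A) = 0.
Proof.
by apply: (addrI (star (0 : A))); rewrite -starD !addr0.
Qed.

(* The norm is carried as an R-valued function, because no structure of the
   library joins normed modules with rings that are not number fields. *)
HB.mixin Record StarAlgebra_isCStar (R : realType) A
    of StarAlgebra R[i] A := {
  cnorm : A -> R;
  cnorm_eq0 : forall x, cnorm x = 0 -> x = 0;
  cnormD : forall x y, cnorm (x + y) <= cnorm x + cnorm y;
  cnormZ : forall (c : R[i]) x, (cnorm (c *: x))%:C = `|c| * (cnorm x)%:C;
  cnormM : forall x y : A, cnorm (x * y) <= cnorm x * cnorm y;
  cnorm_starM : forall x : A, cnorm (star x * x) = cnorm x ^+ 2;
  cnorm_complete : forall u : nat -> A,
    (forall e, 0 < e -> exists N, forall m n,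
       (N <= m)%N -> (N <= n)%N -> cnorm (u m - u n) < e) ->
    exists l, cnorm (u n - l) @[n --> \oo] --> (0 : R) }.

#[short(type="cstarAlgType")]
HB.structure Definition CStarAlgebra (R : realType) :=
  {A of StarAlgebra_isCStar R A & StarAlgebra R[i] A}.

Section CStarSubalgebras.
Context (R : realType) (A : cstarAlgType R).
Implicit Types B J : set A.

Definition norm_closed B := forall (u : nat -> A) l,
  (forall n, B (u n)) -> cnorm (u n - l) @[n --> \oo] --> (0 : R) -> B l.

Definition cstar_subalg B :=
  [/\ B 1,
      forall (c : R[i]) x y, B x -> B y -> B (c *: x + y),
      forall x y, B x -> B y -> B (x * y),
      forall x, B x -> B (star x)
    & norm_closed B].

Definition closed_ideal B J :=
  [/\ J `<=` B, J 0,
      forall (c : R[i]) x y, J x -> J y -> J (c *: x + y),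
      forall b x, B b -> J x -> J (b * x) /\ J (x * b)
    & norm_closed J].

Definition simple B := forall J, closed_ideal B J -> J = [set 0] \/ J = B.

End CStarSubalgebras.

(* Expectations, indices and commutants involve no norm: they only depend on
   the *-algebra structure.  In particular an element of a C*-algebra is
   positive exactly when it is of the form star y * y. *)
Section Expectations.
Context (R : realType) (A : starAlgType R[i]).
Implicit Types (B : set A) (E : {linear A -> A}) (lam : seq A).

Definition commutant B : set A := [set x | forall b, B b -> x * b = b * x].

Definition irreducible B := commutant B = [set c%:A | c in [set: R[i]]].

(* A conditional expectation onto B is a map A -> A with range B. *)
Definition cond_exp B E :=
  [/\ forall x, B (E x),
      forall b, B b -> E b = b,
      forall b x b', B b -> B b' -> E (b * x * b') = b * E x * b'
    & forall x, exists y, E (star x * x) = star y * y].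

Definition quasi_basis E lam :=
  forall x, x = \sum_(l <- lam) l * E (star l * x).

Definition index_finite E := exists lam, quasi_basis E lam.

(* The real number Ind_w(E): for index-finite E on a simple algebra,
   \sum l l^* is a real scalar that does not depend on the quasi-basis. *)
Definition windex E : R := xget 0 [set r : R |
  exists2 lam, quasi_basis E lam & \sum_(l <- lam) l * star l = (r%:C)%:A].

Definition minimal_exp B E :=
  [/\ cond_exp B E, index_finite E
    & forall F : {linear A -> A}, cond_exp B F -> index_finite F ->
        windex E <= windex F].

Definition scalar_of (a : A) : R[i] := xget 0 [set c | a = c%:A].

(* f(a) = \sum_i f(t_i) p_i for a self-adjoint a with finite spectrum and
   spectral decomposition a = \sum_i t_i p_i. *)
Definition fun_calc (f : R -> R) (a : A) : A := xget 0 [set b |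
  exists n (t : 'I_n -> R) (p : 'I_n -> A),
  [/\ forall i, star (p i) = p i,
      forall i j, p i * p j = if i == j then p i else 0,
      \sum_i p i = 1,
      a = \sum_i (t i)%:C *: p i
    & b = \sum_i (f (t i))%:C *: p i]].

(* ln t = 0 for t <= 0 in the library; in particular eta_log 0 = 0. *)
Definition eta_log (t : R) : R := - (t * ln t).

Definition entropy (tr : A -> R[i]) (a : A) : R[i] := tr (fun_calc eta_log a).

End Expectations.

(* The adjointable right B-linear maps of the Hilbert B-module A, with inner
   product E (star x * y).  A map is stored together with its adjoint, which is
   unique as soon as E is faithful (in particular when E is index-finite); the
   two halves of adjoint_of are equivalent when E (star x) = star (E x), which
   holds for every conditional expectation. *)
Section BasicConstruction.
Context (R : realType) (A : starAlgType R[i]) (B : set A) (E : {linear A -> A}).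

Definition right_linear (T : A -> A) :=
  (forall (c : R[i]) x y, T (c *: x + y) = c *: T x + T y) /\
  (forall x b, B b -> T (x * b) = T x * b).

Definition adjoint_of (T S : A -> A) :=
  forall x y, E (star x * T y) = E (star (S x) * y) /\
              E (star x * S y) = E (star (T x) * y).

Record basic := Basic {
  bmap :> A -> A;
  bstar : A -> A;
  bmap_lin : right_linear bmap;
  bstar_lin : right_linear bstar;
  bstarP : adjoint_of bmap bstar }.

Lemma basic_eq (s t : basic) : bmap s =1 bmap t -> bstar s =1 bstar t -> s = t.
Proof.
case: s t => f f' ? ? ? [g g' ? ? ?] /= /funext fg /funext fg'; subst.
by congr Basic; exact: Prop_irrelevance.
Qed.

HB.instance Definition _ := gen_eqMixin basic.
HB.instance Definition _ := gen_choiceMixin basic.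

Lemma right_linearD T S : right_linear T -> right_linear S ->
  right_linear (fun x => T x + S x).
Proof.
move=> [Tl Tb] [Sl Sb]; split=> [c x y|x b Bb]; last by rewrite Tb// Sb// mulrDl.
by rewrite Tl Sl scalerDr addrACA.
Qed.

Lemma right_linearZ (c : R[i]) T : right_linear T ->
  right_linear (fun x => c *: T x).
Proof.
move=> [Tl Tb]; split=> [d x y|x b Bb]; last by rewrite Tb// scalerAl.
by rewrite Tl scalerDr !scalerA mulrC.
Qed.

Lemma right_linear_comp T S : right_linear T -> right_linear S ->
  right_linear (fun x => T (S x)).
Proof.
by move=> [Tl Tb] [Sl Sb]; split=> [c x y|x b Bb]; [rewrite Sl Tl|rewrite Sb// Tb].
Qed.

Lemma right_linear_id : right_linear id. Proof. by []. Qed.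

Lemma right_linear0 : right_linear (fun=> 0).
Proof. by split=> *; rewrite ?mul0r// scaler0 addr0. Qed.

Lemma right_linear_mul a : right_linear (fun x => a * x).
Proof. by split=> [c x y|x b _]; rewrite ?mulrA// mulrDr scalerAr. Qed.

Lemma basic0_subproof : adjoint_of (fun=> 0) (fun=> 0).
Proof. by move=> x y; rewrite mulr0 star0 mul0r. Qed.

Lemma basic1_subproof : adjoint_of id id. Proof. by []. Qed.

Lemma basicD_subproof (s t : basic) :
  adjoint_of (fun x => bmap s x + bmap t x) (fun x => bstar s x + bstar t x).
Proof.
move=> x y; have [s1 s2] := bstarP s x y; have [t1 t2] := bstarP t x y.
by rewrite !mulrDr !linearD s1 s2 t1 t2 !starD !mulrDl !linearD.
Qed.

Lemma basicZ_subproof (c : R[i]) (s : basic) :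
  adjoint_of (fun x => c *: bmap s x) (fun x => Num.conj c *: bstar s x).
Proof.
move=> x y; have [s1 s2] := bstarP s x y.
by rewrite -!scalerAr !linearZ/= s1 s2 !starZ conjCK -!scalerAl !linearZ.
Qed.

Lemma basicM_subproof (s t : basic) :
  adjoint_of (fun x => bmap s (bmap t x)) (fun x => bstar t (bstar s x)).
Proof.
move=> x y; split.
  by rewrite (bstarP s x _).1 (bstarP t _ y).1.
by rewrite (bstarP t x _).2 (bstarP s _ y).2.
Qed.

Lemma basicS_subproof (s : basic) : adjoint_of (bstar s) (bmap s).
Proof. by move=> x y; have [] := bstarP s x y. Qed.

Lemma lmul_subproof a : adjoint_of (fun x => a * x) (fun x => star a * x).
Proof. by move=> x y; rewrite !starM starK !mulrA. Qed.

Definition basic0 := Basic right_linear0 right_linear0 basic0_subproof.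

Definition basic1 := Basic right_linear_id right_linear_id basic1_subproof.

Definition basic_add (s t : basic) :=
  Basic (right_linearD (bmap_lin s) (bmap_lin t))
        (right_linearD (bstar_lin s) (bstar_lin t)) (basicD_subproof s t).

Definition basic_scale (c : R[i]) (s : basic) :=
  Basic (right_linearZ c (bmap_lin s))
        (right_linearZ (Num.conj c) (bstar_lin s)) (basicZ_subproof c s).

Definition basic_mul (s t : basic) :=
  Basic (right_linear_comp (bmap_lin s) (bmap_lin t))
        (right_linear_comp (bstar_lin t) (bstar_lin s)) (basicM_subproof s t).

Definition basic_star (s : basic) :=
  Basic (bstar_lin s) (bmap_lin s) (basicS_subproof s).

Let addA : associative basic_add.
Proof. by move=> s t u; apply: basic_eq => x /=; rewrite addrA. Qed.

Let addC : commutative basic_add.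
Proof. by move=> s t; apply: basic_eq => x /=; rewrite addrC. Qed.

Let add0 : left_id basic0 basic_add.
Proof. by move=> s; apply: basic_eq => x /=; rewrite add0r. Qed.

Let addN : left_inverse basic0 (basic_scale (- 1)) basic_add.
Proof.
by move=> s; apply: basic_eq => x /=; rewrite ?rmorphN1 scaleN1r addNr.
Qed.

HB.instance Definition _ := GRing.isZmodule.Build basic addA addC add0 addN.

Let mulA : associative basic_mul. Proof. by move=> s t u; exact: basic_eq. Qed.

Let mul1 : left_id basic1 basic_mul. Proof. by move=> s; exact: basic_eq. Qed.

Let mulr1 : right_id basic1 basic_mul. Proof. by move=> s; exact: basic_eq. Qed.

Let rlD T x y : right_linear T -> T (x + y) = T x + T y.
Proof. by case=> /(_ 1 x y); rewrite !scale1r. Qed.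

Let rlZ T (c : R[i]) x : right_linear T -> T (c *: x) = c *: T x.
Proof.
move=> hT; have T0 : T 0 = 0.
  by apply: (addrI (T 0)); rewrite -rlD// !addr0.
by case: hT => /(_ c x 0); rewrite T0 !addr0.
Qed.

Let mulDl : left_distributive basic_mul +%R.
Proof.
by move=> s t u; apply: basic_eq => x //=; rewrite rlD//; exact: bstar_lin.
Qed.

Let mulDr : right_distributive basic_mul +%R.
Proof.
by move=> s t u; apply: basic_eq => x //=; rewrite rlD//; exact: bmap_lin.
Qed.

Let one_neq0 : basic1 != 0.
Proof. by apply/eqP => /(congr1 (@bmap ^~ 1)) /eqP; rewrite oner_eq0. Qed.

HB.instance Definition _ :=
  GRing.Zmodule_isNzRing.Build basic mulA mul1 mulr1 mulDl mulDr one_neq0.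

Let scaleA (c d : R[i]) s :
  basic_scale c (basic_scale d s) = basic_scale (c * d) s.
Proof. by apply: basic_eq => x /=; rewrite scalerA// rmorphM. Qed.

Let scale1 : left_id 1 basic_scale.
Proof. by move=> s; apply: basic_eq => x /=; rewrite ?rmorph1 scale1r. Qed.

Let scaleDr : right_distributive basic_scale +%R.
Proof. by move=> c s t; apply: basic_eq => x /=; rewrite scalerDr. Qed.

Let scaleDl s : {morph basic_scale^~ s : c d / c + d}.
Proof. by move=> c d; apply: basic_eq => x /=; rewrite ?rmorphD scalerDl. Qed.

HB.instance Definition _ :=
  GRing.Zmodule_isLmodule.Build R[i] basic scaleA scale1 scaleDr scaleDl.

Let scaleAl (c : R[i]) (s t : basic) : c *: (s * t) = c *: s * t.
Proof.
by apply: basic_eq => x //=; rewrite rlZ//; exact: bstar_lin.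
Qed.

HB.instance Definition _ :=
  GRing.LSemiModule_isLSemiAlgebra.Build R[i] basic scaleAl.

Let scaleAr (c : R[i]) (s t : basic) : c *: (s * t) = s * (c *: t).
Proof.
by apply: basic_eq => x //=; rewrite rlZ//; exact: bmap_lin.
Qed.

HB.instance Definition _ :=
  GRing.LSemiAlgebra_isSemiAlgebra.Build R[i] basic scaleAr.

Let bstarK : involutive basic_star.
Proof. by move=> s; exact: basic_eq. Qed.

Let bstarD : {morph basic_star : s t / s + t}.
Proof. by move=> s t; exact: basic_eq. Qed.

Let bstarM (s t : basic) : basic_star (s * t) = basic_star t * basic_star s.
Proof. exact: basic_eq. Qed.

Let bstarZ (c : R[i]) (s : basic) :
  basic_star (c *: s) = Num.conj c *: basic_star s.
Proof. by apply: basic_eq => x //=; rewrite conjCK. Qed.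

HB.instance Definition _ :=
  Algebra_hasStar.Build R[i] basic bstarK bstarD bstarM bstarZ.

Definition lmul (a : A) : basic :=
  Basic (right_linear_mul a) (right_linear_mul (star a)) (lmul_subproof a).

(* The adjointable map T, or 0 if T is not adjointable and right B-linear. *)
Definition as_basic (T : A -> A) : basic := xget 0 [set t : basic | bmap t = T].

End BasicConstruction.

Arguments lmul {R A B E}.
Arguments as_basic {R A B E}.

Section Tower.
Context (R : realType) (A : starAlgType R[i]) (B : set A) (E : {linear A -> A}).
Local Notation A1 := (basic B E).
Context (E1 : {linear A1 -> A1}).
Local Notation A2 := (basic (range (lmul : A -> A1)) E1).
Context (E2 : {linear A2 -> A2}).

(* E_1 x and E_2 x are left multiplications lmul a, and then a = lmul a 1. *)
Definition tr1 (x : A1) : R[i] := scalar_of (E (E1 x 1)).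
Definition tr2 (x : A2) : R[i] := tr1 (E2 x 1).

Definition delta : R := Num.sqrt (windex E).

Definition e1 : A1 := as_basic E.
Definition e2 : A2 := as_basic E1.

(* The expectation from B' `&` A_2 onto A' `&` A_2; lam is a quasi-basis of E. *)
Definition commutant_exp (lam : seq A) (y : A2) : A2 :=
  ((windex E)^-1)%:C *: \sum_(l <- lam) lmul (lmul l) * y * star (lmul (lmul l) : A2).

Definition fourier (lam : seq A) (x : A1) : A2 :=
  (delta ^+ 3)%:C *: commutant_exp lam (lmul x * e2 * lmul e1).
End Tower.

(* Main.v *)
Require Import Defs.
From HB Require Import structures.
From mathcomp Require Import all_boot all_order all_algebra.
From mathcomp Require Import all_classical all_reals all_analysis.
From mathcomp Require Import complex.
From mathcomp Require Import ring lra.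
Set Implicit Arguments.
Unset Strict Implicit.
Unset Printing Implicit Defensive.
Import Order.TTheory GRing.Theory Num.Theory numFieldNormedType.Exports.
Local Open Scope classical_set_scope.
Local Open Scope ring_scope.
Local Open Scope complex_scope.

(* Let nu_k = E_D(lambda_k), a quasi-basis of the restriction of E to D, and
   tau = delta^-2, so that E_1(a e_1 b) = tau a b.  Under A_1 = A (x)_B A the
   operator F(x) is a e_1 b |-> delta^-1 a x b.  Since
   Theta = sum_k E_C(nu_k) e_1 nu_k^*, this gives
   F(Theta)^2 (a e_1) = delta^-2 a sum_k E_C(nu_k) Theta nu_k^*, and
   sum_k nu_k E_C(nu_k^* y) = kappa y for y in D, where
   kappa = sum_k nu_k E_C(nu_k)^* lies in B' and hence is a scalar.
   So F(Theta)^2 = (kappa / delta) F(Theta); F(Theta) is self-adjoint, and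
   kappa >= 1 because E_1 is positive on (Theta - e_1)^* (Theta - e_1).  Thus
   F(Theta) = s P with P a projection and s = kappa / delta = delta tr(Theta),
   while tr(F(Theta)) = 1 / delta; hence
   H(s^2 P) = eta(s^2) / (s delta) = 2 eta(s) / delta. *)

(** * Star algebras and conditional expectations *)

Section Star.
Context (K : numClosedFieldType) (A : starAlgType K).
Implicit Types x y : A.

Lemma starN x : star (- x) = - star x.
Proof. by rewrite -scaleN1r starZ rmorphN1 scaleN1r. Qed.

Lemma starB x y : star (x - y) = star x - star y.
Proof. by rewrite starD starN. Qed.

Lemma star1 : star (1 : A) = 1.
Proof.
by rewrite -[LHS]mulr1 -[X in _ * X](starK (1 : A)) -starM mulr1 starK.
Qed.

Lemma star_sum I (s : seq I) (F : I -> A) :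
  star (\sum_(i <- s) F i) = \sum_(i <- s) star (F i).
Proof. exact: (big_morph _ (@starD _ A) (star0 A)). Qed.

Lemma star_scalar (c : K) : star (c%:A : A) = (Num.conj c)%:A.
Proof. by rewrite starZ star1. Qed.

End Star.

Lemma scalar_inj (K : fieldType) (A : algType K) :
  injective (fun c : K => c%:A : A).
Proof.
move=> c d /eqP; rewrite -subr_eq0 -scalerBl scaler_eq0 oner_eq0 orbF.
by rewrite subr_eq0 => /eqP.
Qed.

Lemma conj_real (R : realType) (x : R) : Num.conj (x%:C) = x%:C.
Proof. by rewrite conj_Creal// complex_real. Qed.

(** * Functional calculus for finite spectral decompositions *)

Section FunctionalCalculus.
Context (R : realType) (A : starAlgType R[i]).

(** For a second decomposition of [a], with values u_j and projections q_j, the product p_i q_j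
    vanishes unless t_i = u_j. Both candidate values therefore equal the sum of f(t_i) p_i q_j over
    all pairs, so the choice made in [fun_calc] is immaterial. *)
Lemma fun_calc_eq (f : R -> R) (a : A) n (t : 'I_n -> R) (p : 'I_n -> A) :
    (forall i, star (p i) = p i) ->
    (forall i j, p i * p j = if i == j then p i else 0) ->
    \sum_i p i = 1 -> a = \sum_i (t i)%:C *: p i ->
  fun_calc f a = \sum_i (f (t i))%:C *: p i.
Proof.
move=> sp pp p1 at_.
rewrite /fun_calc; case: xgetP => [b _|/(_ (\sum_i (f (t i))%:C *: p i))];
  last first.
  by case; exists n, t, p; split.
move=> [m [u [q [sq qq q1 au ->]]]].
have pq i j : (f (t i))%:C *: (p i * q j) = (f (u j))%:C *: (p i * q j).
  have [->//|tu] := eqVneq (t i) (u j).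
  suff -> : p i * q j = 0 by rewrite !scaler0.
  (* Evaluating p_i a q_j from either side gives t_i p_i q_j = u_j p_i q_j. *)
  have : p i * a * q j = (t i)%:C *: (p i * q j).
    rewrite at_ mulr_sumr (bigD1 i)//= big1 ?addr0 => [|k ki].
      by rewrite -scalerAr pp eqxx scalerAl.
    by rewrite -scalerAr pp eq_sym (negPf ki) scaler0.
  have -> : p i * a * q j = (u j)%:C *: (p i * q j).
    rewrite -mulrA au mulr_suml (bigD1 j)//= big1 ?addr0 => [|k kj].
      by rewrite -scalerAl qq eqxx -scalerAr.
    by rewrite -scalerAl qq (negPf kj) scaler0.
  move/eqP; rewrite -subr_eq0 -scalerBl scaler_eq0 subr_eq0 => /orP[|/eqP//].
  by move=> /eqP/complexI ut; rewrite ut eqxx in tu.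
transitivity (\sum_j \sum_i (f (u j))%:C *: (p i * q j)).
  by apply: eq_bigr => j _; rewrite -scaler_sumr -mulr_suml p1 mul1r.
rewrite exchange_big/=; apply: eq_bigr => i _.
under eq_bigr do rewrite -pq.
by rewrite -scaler_sumr -mulr_sumr q1 mulr1.
Qed.

(** The decomposition is s p + 0 (1 - p), and [f 0 = 0] removes the second term. Zero projections
    and repeated values are allowed, so p = 0, p = 1 and s = 0 are no exceptions. *)
Lemma fun_calc_proj (f : R -> R) (s : R) (p : A) :
  f 0 = 0 -> star p = p -> p * p = p ->
  fun_calc f (s%:C *: p) = (f s)%:C *: p.
Proof.
move=> f0 sp pp.
pose P (i : 'I_2) : A := if i == 0 then p else 1 - p.
pose t (i : 'I_2) : R := if i == 0 then s else 0.
rewrite (@fun_calc_eq f _ 2 t P).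
- by rewrite !big_ord_recl big_ord0 /P /t/= f0 scale0r !addr0.
- by move=> i; rewrite /P; case: ifP; rewrite // starB star1 sp.
- move=> i j; rewrite /P; case: i j => -[|[|//]] ? [[|[|//]] ?] /=;
  by rewrite ?mulrBl ?mulrBr ?mul1r ?mulr1 pp ?subrr// subr0.
- by rewrite !big_ord_recl big_ord0 /P /= addr0 addrC subrK.
- by rewrite !big_ord_recl big_ord0 /P /t/= scale0r !addr0.
Qed.

End FunctionalCalculus.

(** * Bimodule and symmetry properties of conditional expectations *)

Section CondExp.
Context (R : realType) (A : starAlgType R[i]) (B : set A) (E : {linear A -> A}).
Hypotheses (B1 : B 1) (hE : cond_exp B E).

Lemma cond_exp_in x : B (E x). Proof. by case: hE. Qed.

Lemma cond_exp_id b : B b -> E b = b. Proof. by case: hE => _ + _ _; apply. Qed.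

Lemma cond_expMl b x : B b -> E (b * x) = b * E x.
Proof. by case: hE => _ _ h _ Bb; have := h b x 1 Bb B1; rewrite !mulr1. Qed.

Lemma cond_expMr b x : B b -> E (x * b) = E x * b.
Proof. by case: hE => _ _ h _ Bb; have := h 1 x b B1 Bb; rewrite !mul1r. Qed.

Lemma cond_exp_scalar (c : R[i]) : E c%:A = c%:A.
Proof. by rewrite linearZ/= cond_exp_id. Qed.

(* Polarization: E (star y * y) is self-adjoint for y = 1 + x and 1 + 'i x. *)
Lemma cond_exp_star x : E (star x) = star (E x).
Proof.
have sa y : star (E (star y * y)) = E (star y * y).
  by case: hE => _ _ _ /(_ y) [z ->]; rewrite starM starK.
have polar y : star (E y) + star (E (star y)) = E y + E (star y).
  have := sa (1 + y).
  rewrite starD star1 mulrDl !mulrDr !mulr1 mul1r !linearD/= !starD sa.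
  by rewrite cond_exp_id// star1 -!addrA => /addrI; rewrite !addrA => /addIr.
have h1 := polar x; have := polar ('i *: x).
rewrite !linearZ/= !starZ !linearZ/= !starZ conjCi !rmorphN/= conjCi.
rewrite opprK !scaleNr addrC -!scalerBr => /(scalerI (neq0Ci _)) h2.
have : star (E x) + star (E x) = E (star x) + E (star x).
  have := congr2 (fun u v => u - v) h1 h2.
  by rewrite !opprB [E x + _]addrC [LHS]addrACA [RHS]addrACA !subrr !addr0.
by rewrite -![_ + _](scaler_nat 2) => /scalerI ->//; rewrite pnatr_eq0.
Qed.

Lemma cond_exp_sym x y : E (star (E x) * y) = E (star x * E y).
Proof.
rewrite -cond_exp_star cond_expMl ?cond_expMr//; exact: cond_exp_in.
Qed.

Lemma cond_exp_adj x y : E (E x * y) = E (x * E y).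
Proof. by rewrite cond_expMl ?cond_expMr//; exact: cond_exp_in. Qed.

End CondExp.

(** * Scalars of the form w^* w in a C*-algebra *)

Section CStarPositivity.
Context (R : realType) (A : cstarAlgType R).
Implicit Types x y a b : A.

Lemma cnormZr (r : R) x : cnorm (r%:C *: x) = `|r| * cnorm x.
Proof.
by apply: complexI; rewrite cnormZ rmorphM/= normc_def/= expr0n/= addr0
  sqrtr_sqr.
Qed.

Lemma cnorm0 : cnorm (0 : A) = 0.
Proof. by rewrite -(scale0r (0 : A)) (cnormZr 0) normr0 mul0r. Qed.

Lemma cnorm_ge0 x : 0 <= cnorm x.
Proof.
have := cnormD x (- x); rewrite subrr cnorm0.
have -> : - x = (-1)%:C *: x by rewrite rmorphN1 scaleN1r.
by rewrite cnormZr normrN1 mul1r -mulr2n pmulrn_lge0.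
Qed.

Lemma cnormN x : cnorm (- x) = cnorm x.
Proof.
by rewrite -scaleN1r -(rmorphN1 (real_complex R)) cnormZr normrN1 mul1r.
Qed.

Lemma cnorm_star x : cnorm (star x) = cnorm x.
Proof.
have le y : cnorm y <= cnorm (star y).
  have [->|y0] := eqVneq (cnorm y) 0; first exact: cnorm_ge0.
  have y_gt0 : 0 < cnorm y by rewrite lt_def y0 cnorm_ge0.
  by rewrite -(ler_pM2r y_gt0) -expr2 -cnorm_starM cnormM.
by apply/eqP; rewrite eq_le le -{2}(starK x) le.
Qed.

Lemma star_mul_eq0 x : star x * x = 0 -> x = 0.
Proof.
move=> x0; apply: cnorm_eq0; apply/eqP.
by rewrite -sqrf_eq0 -cnorm_starM x0 cnorm0.
Qed.

Lemma cnorm_sa a : star a = a -> cnorm (a * a) = cnorm a ^+ 2.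
Proof. by move=> sa; rewrite -cnorm_starM sa. Qed.

Lemma cnorm1 : cnorm (1 : A) = 1.
Proof.
have n1 : cnorm (1 : A) != 0.
  by apply/eqP => /cnorm_eq0/eqP; rewrite oner_eq0.
by apply: (mulfI n1); rewrite mulr1 -expr2 -cnorm_starM star1 mulr1.
Qed.

(* b +- 'i a have equal norms, and their sum is 2 b. *)
Lemma cnorm_sum_sqr a b : star a = a -> star b = b -> a * b = b * a ->
  cnorm b ^+ 2 <= cnorm (a * a + b * b).
Proof.
move=> sa sb ab.
pose z := b + 'i *: a; pose w := b - 'i *: a.
have sz : star z = w by rewrite /z starD starZ conjCi sa sb scaleNr.
have zz : star z * z = a * a + b * b.
  rewrite sz /z /w mulrDr !mulrBl -!scalerAl -!scalerAr ab scalerA.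
  by rewrite -(expr2 'i) sqrCi scaleN1r opprK addrA subrK addrC.
rewrite -zz cnorm_starM lerXn2r ?nnegrE ?cnorm_ge0//.
have : cnorm (z + w) <= cnorm z + cnorm w := cnormD _ _.
rewrite -sz cnorm_star sz /z /w addrACA subrr addr0 -mulr2n -scaler_nat.
have -> : (2%:R : R[i]) = (2%:R)%:C by rewrite rmorph_nat.
by rewrite cnormZr ger0_norm//; lra.
Qed.

(** If the sum were -1, both squares would have norm at most 1/4, which is too small. The bound on
    y^2 comes from (1 - y^2)^2 + (2y)^2 = (1 + y^2)^2 = x^4, whose norm is at most 1 and dominates
    that of 2y squared by [cnorm_sum_sqr]. *)
Lemma sum_sqr_neqN1 a b : star a = a -> star b = b -> a * b = b * a ->
  a * a + b * b <> -1.
Proof.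
suff half x y : star x = x -> star y = y -> x * y = y * x ->
    x * x + y * y = -1 -> cnorm (y * y) <= 4^-1.
  move=> sa sb ab e.
  have h1 := half _ _ sa sb ab e.
  have h2 : cnorm (a * a) <= 4^-1 by apply: (half b a) => //; rewrite addrC.
  have := cnormD (a * a) (b * b); rewrite e cnormN cnorm1; lra.
move=> sx sy xy e.
have x1 : cnorm (x * x) <= 1.
  rewrite cnorm_sa//; have := cnorm_sum_sqr sy sx (esym xy).
  by rewrite addrC e cnormN cnorm1.
have yyE : 1 + y * y = - (x * x).
  by apply/eqP; rewrite -subr_eq0 opprK -addrA [y * y + _]addrC e subrr.
have sqrE : (1 - y * y) * (1 - y * y) + (2%:R *: y) * (2%:R *: y) =
            (1 + y * y) * (1 + y * y).
  have -> : (2%:R *: y) * (2%:R *: y) = (y * y + y * y) + (y * y + y * y).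
    rewrite -scalerAl -scalerAr scalerA -natrM scaler_nat.
    by rewrite -[(2 * 2)%N]/(2 + 2)%N mulrnDr !mulr2n.
  move: (y * y) => Y.
  rewrite !mulrDr !mulrDl !mulr1 !mul1r mulrNN.
  rewrite [LHS]addrACA ![_ + _ + (Y + Y)]addrACA.
  by rewrite addNr add0r addr0 [Y * Y + Y]addrC.
have : cnorm (2%:R *: y) ^+ 2 <= 1.
  apply: le_trans (cnorm_sum_sqr (a := 1 - y * y) _ _ _) _.
  - by rewrite starB star1 starM sy.
  - by rewrite starZ sy conjC_nat.
  - by rewrite -scalerAl -scalerAr mulrBl mulrBr mul1r mulr1 mulrA.
  rewrite sqrE yyE mulrNN cnorm_sa; last by rewrite starM sx.
  by rewrite expr_le1// cnorm_ge0.
have -> : (2%:R : R[i]) = (2%:R)%:C by rewrite rmorph_nat.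
rewrite cnormZr ger0_norm// cnorm_sa// exprMn; lra.
Qed.

(* If star u * u = -1, then h = u + star u satisfies q (1 + h^2) q = 0 for the
   projection q = 1 + u * star u, so q = 0 and u is normal. *)
Lemma star_mul_neqN1 (u : A) : star u * u <> -1.
Proof.
move=> uu; pose q := 1 + u * star u.
have uuu : u * star u * u = - u by rewrite -mulrA uu mulrN1.
have suu : star u * (u * star u) = - star u by rewrite mulrA uu mulN1r.
have sq : star q = q by rewrite /q starD star1 starM starK.
have qu : q * u = 0 by rewrite /q mulrDl mul1r uuu subrr.
have uq : star u * q = 0 by rewrite /q mulrDr mulr1 suu subrr.
have qq : q * q = q by rewrite {1}/q mulrDl mul1r -mulrA uq mulr0 addr0.
(* The element v = q + c u q satisfies v^* v = q + q u^* u q = 0; adding the cases c = 'i and c =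
   -'i then gives 2 q = 0. *)
have h0 (c : R[i]) : Num.conj c = - c -> c * c = -1 -> q + c *: (u * q) = 0.
  move=> cc c2; apply: star_mul_eq0.
  have -> : star (q + c *: (u * q)) = q - c *: (q * star u).
    by rewrite starD starZ starM sq cc scaleNr.
  rewrite mulrDr !mulrBl -!scalerAl -!scalerAr scalerA c2 qq.
  rewrite -(mulrA q (star u) q) uq mulr0 scaler0 subr0 !mulrA qu mul0r scaler0
    add0r.
  by rewrite scaleN1r opprK -(mulrA q (star u)) uu mulrN1 mulNr qq subrr.
have q0 : q = 0.
  have e1 : q + 'i *: (u * q) = 0.
    by apply: h0; rewrite ?conjCi// -expr2 sqrCi.
  have e2 : q - 'i *: (u * q) = 0.
    by rewrite -scaleNr; apply: h0; rewrite ?rmorphN/= ?conjCi// mulrNN -expr2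
      sqrCi.
  have : q + q = (q + 'i *: (u * q)) + (q - 'i *: (u * q)).
    by rewrite [RHS]addrACA subrr addr0.
  rewrite e1 e2 addr0 -[q + q](scaler_nat 2) => /eqP.
  by rewrite scaler_eq0 pnatr_eq0/= => /eqP.
have uu' : u * star u = -1 by apply/eqP; rewrite -subr_eq0 opprK addrC -/q q0.
(* [k] and [ki] are the coefficients of the real and imaginary parts of the now normal [u]. These
   parts commute, and their squares add up to (u u^* + u^* u) / 2 = -1. *)
pose k : R[i] := 2%:R^-1; pose ki : R[i] := 2%:R^-1 * 'i.
have k2 : k * k + k * k = 2%:R^-1.
  by rewrite /k; field.
have cjk : Num.conj k = k by rewrite /k conj_Creal// realV realn.
have cjki : Num.conj ki = - ki by rewrite rmorphM/= conjCi -/k cjk mulrN.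
apply: (@sum_sqr_neqN1 (k *: (u + star u)) (ki *: (star u - u))).
- by rewrite starZ starD starK addrC cjk.
- by rewrite starZ starB starK cjki scaleNr -scalerN opprB.
- rewrite -!scalerAl -!scalerAr !scalerA mulrC; congr (_ *: _).
  rewrite !mulrDr !mulrDl !mulrN !mulNr uu uu'.
  by rewrite addrACA.
rewrite -!scalerAl -!scalerAr !scalerA.
have -> : ki * ki = - (k * k) by rewrite mulrACA -(expr2 'i) sqrCi mulrN1.
rewrite scaleNr -scalerBr.
rewrite !mulrDr !mulrDl !mulrN !mulNr uu uu' !opprK.
have -> (P Q : A) : P - 1 + (-1 + Q) - (Q + 1 + (1 + P)) =
  - ((1 + 1) + (1 + 1)).
  rewrite [-1 + Q]addrC [P - 1 + _]addrACA [Q + 1]addrC [1 + Q + _]addrACA.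
  by rewrite [Q + P]addrC opprD [- (1 + 1) - _]addrC [LHS]addrACA subrr add0r
    !opprD.
rewrite scalerN !scalerDr -!scalerDl k2; congr (- _).
by have -> : 2%:R^-1 + 2%:R^-1 = 1 :> R[i]; [field | rewrite scale1r].
Qed.

(** Self-adjointness of w^* w makes k real; if k < 0, the rescaled element (-k)^(-1/2) w contradicts
    [star_mul_neqN1]. *)
Lemma star_mul_scalar_ge0 (w : A) (k : R[i]) : star w * w = k%:A -> 0 <= k.
Proof.
move=> wk.
have /CrealP kR : Num.conj k = k.
  by apply: (@scalar_inj _ A); rewrite -star_scalar -wk starM starK.
rewrite real_leNgt ?real0//; apply/negP => k0.
pose c := (sqrtC (- k))^-1.
have c0 : 0 <= c by rewrite invr_ge0 sqrtC_ge0 oppr_ge0 ltW.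
apply: (@star_mul_neqN1 (c *: w)).
rewrite starZ (conj_Creal (ger0_real c0)) -scalerAl -scalerAr scalerA wk
  scalerA.
rewrite -expr2 exprVn sqrtCK invrN mulNr mulVf ?lt_eqF// scaleN1r //.
Qed.

End CStarPositivity.

(** * Quasi-bases and the basic construction *)

Section QuasiBasis.
Context (R : realType) (A : starAlgType R[i]) (B : set A) (E : {linear A -> A}).
Hypotheses (B1 : B 1) (hE : cond_exp B E).
Context (lam : seq A).
Hypothesis lam_basis : quasi_basis E lam.

Lemma quasi_basis_star x : x = \sum_(l <- lam) E (x * l) * star l.
Proof.
rewrite -[LHS]starK [in LHS](lam_basis (star x)) star_sum;
  apply: eq_bigr => l _.
by rewrite starM -(cond_exp_star B1 hE) starM !starK.
Qed.

Lemma cond_exp_nondeg x : (forall y, E (star y * x) = 0) -> x = 0.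
Proof.
by move=> h; rewrite (lam_basis x) big1// => l _; rewrite h mulr0.
Qed.

Lemma cond_exp_nondegr x : (forall y, E (x * y) = 0) -> x = 0.
Proof.
by move=> h; rewrite (quasi_basis_star x) big1// => l _; rewrite h mul0r.
Qed.

(* F = E (h * _) with h := \sum F(l) l^*, and h lies in the commutant of B. *)
Lemma cond_exp_unique (F : {linear A -> A}) :
  irreducible B -> cond_exp B F -> F =1 E.
Proof.
move=> irr hF; pose h := \sum_(l <- lam) F l * star l.
have FE x : F x = E (h * x).
  rewrite [in LHS](lam_basis x) /h mulr_suml !linear_sum; apply: eq_bigr => l _.
  have Fl : B (F l) := cond_exp_in hF l.
  have El : B (E (star l * x)) := cond_exp_in hE _.
  by rewrite /= (cond_expMr B1 hF _ El) -mulrA (cond_expMl B1 hE _ Fl).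

have : commutant B h.
  move=> b Bb; apply/eqP; rewrite -subr_eq0; apply/eqP.
  apply: cond_exp_nondegr => y; rewrite mulrBl linearB/= -!mulrA -FE.
  by rewrite (cond_expMl B1 hF)// (cond_expMl B1 hE)// FE subrr.
rewrite irr => -[c _ hc] x; rewrite FE -hc -scalerAl mul1r linearZ/=.
have := FE 1; rewrite -hc mulr1 (cond_exp_scalar B1 hE) (cond_exp_id hF B1).
by rewrite -{1}(scale1r 1) => /scalar_inj <-; rewrite scale1r.
Qed.

End QuasiBasis.

(** * Left multiplications, the Jones projection and [E1] on the basic construction *)

Section BasicTheory.
Context (R : realType) (A : starAlgType R[i]) (B : set A) (E : {linear A -> A}).
Local Notation A1 := (basic B E).
Implicit Types (s t : A1) (a b x y : A) (c : R[i]).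

Lemma bmapD t x y : t (x + y) = t x + t y.
Proof. by have [/(_ 1 x y)] := bmap_lin t; rewrite !scale1r. Qed.

Lemma bmap0 t : t 0 = 0.
Proof. by apply: (addrI (t 0)); rewrite -bmapD !addr0. Qed.

Lemma bmapZ t c x : t (c *: x) = c *: t x.
Proof. by have [/(_ c x 0)] := bmap_lin t; rewrite bmap0 !addr0. Qed.

Lemma bmap_sum t I (r : seq I) (F : I -> A) :
  t (\sum_(i <- r) F i) = \sum_(i <- r) t (F i).
Proof. exact: (big_morph _ (bmapD t) (bmap0 t)). Qed.

Lemma bmapMr t x b : B b -> t (x * b) = t x * b.
Proof. by have [_] := bmap_lin t; apply. Qed.

Lemma sum_bmap I (r : seq I) (F : I -> A1) x :
  (\sum_(i <- r) F i) x = \sum_(i <- r) F i x.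
Proof. by apply: (big_morph (fun t : A1 => t x)). Qed.

Lemma mul_bmap s t x : (s * t) x = s (t x). Proof. by []. Qed.

Lemma scale_bmap c t x : (c *: t) x = c *: t x. Proof. by []. Qed.

Lemma lmul_bmap a x : (lmul a : A1) x = a * x. Proof. by []. Qed.

Hypotheses (B1 : B 1) (hE : cond_exp B E).
Context (lam : seq A).
Hypothesis lam_basis : quasi_basis E lam.

(** Nondegeneracy makes the adjoint unique, so operators can be compared by their values on vectors
    alone. *)
Lemma basic_ext s t : bmap s =1 bmap t -> s = t.
Proof.
move=> st; apply: basic_eq => // x.
apply/eqP; rewrite -subr_eq0 -(inj_eq (can_inj (@starK _ A))) star0; apply/eqP.
apply: (cond_exp_nondegr B1 hE lam_basis) => y.
by rewrite starB mulrBl linearB/= -(bstarP s x y).1 -(bstarP t x y).1 st subrr.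
Qed.

Lemma lmul_inj a b : (lmul a : A1) = lmul b -> a = b.
Proof. by move/(congr1 (fun t : A1 => t 1)); rewrite !lmul_bmap !mulr1. Qed.

Lemma lmulM a b : (lmul (a * b) : A1) = lmul a * lmul b.
Proof. by apply: basic_ext => x; rewrite mul_bmap !lmul_bmap mulrA. Qed.

Lemma lmul1 : (lmul 1 : A1) = 1.
Proof. by apply: basic_ext => x; rewrite lmul_bmap mul1r. Qed.

Lemma lmulZ c a : (lmul (c *: a) : A1) = c *: lmul a.
Proof. by apply: basic_ext => x; rewrite scale_bmap !lmul_bmap scalerAl. Qed.

Lemma lmul_star a : star (lmul a : A1) = lmul (star a).
Proof. by apply: basic_ext. Qed.

Lemma lmul_sum I (r : seq I) (F : I -> A) :
  (lmul (\sum_(i <- r) F i) : A1) = \sum_(i <- r) lmul (F i).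
Proof.
by apply: basic_ext => x; rewrite sum_bmap lmul_bmap mulr_suml.
Qed.

Lemma range_lmul1 : range (lmul : A -> A1) 1.
Proof. by exists 1; rewrite // lmul1. Qed.

Lemma as_basicE (T S : A -> A) : right_linear B T -> right_linear B S ->
  adjoint_of E T S -> bmap (as_basic T : A1) = T.
Proof.
move=> Tl Sl TS; rewrite /as_basic; case: xgetP => [t _ //|].
by move=> /(_ (Basic Tl Sl TS)) /(_ erefl).
Qed.

(** Because E F = E, the map F is symmetric for the inner product of E and is its own adjoint;
    [as_basic F] is thus the genuine Jones projection and not the default 0. *)
Lemma cond_exp_as_basic (C : set A) (F : {linear A -> A}) :
  C 1 -> B `<=` C -> cond_exp C F -> E \o F =1 E ->
  bmap (as_basic F : A1) = F.
Proof.
move=> C1 BC hF EF.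
have Fr : right_linear B F.
  by split=> [c x y|x b /BC Cb]; rewrite ?linearP// (cond_expMr C1 hF).
apply: (as_basicE Fr Fr); rewrite /adjoint_of => x y.
suff : E (star x * F y) = E (star (F x) * y) by [].
by rewrite -[LHS]EF -[RHS]EF /= (cond_exp_sym C1 hF).
Qed.

Lemma e1_bmap : bmap (e1 B E) = E.
Proof.
apply: (cond_exp_as_basic B1) => // x /=.
by rewrite (cond_exp_id hE)//; exact: (cond_exp_in hE).
Qed.

Lemma basic_self_adj t : (forall x y, E (star x * t y) = E (star (t x) * y)) ->
  star t = t.
Proof.
move=> sa; apply: basic_ext => x; apply/eqP; rewrite -subr_eq0; apply/eqP.
apply: (cond_exp_nondeg lam_basis) => y.
by rewrite mulrBr linearB/= (bstarP t y x).2 sa subrr.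
Qed.

Lemma e1_star : star (e1 B E) = e1 B E.
Proof.
by apply: basic_self_adj => x y; rewrite e1_bmap (cond_exp_sym B1 hE).
Qed.

Lemma e1_idem : e1 B E * e1 B E = e1 B E.
Proof.
apply: basic_ext => x; rewrite mul_bmap !e1_bmap (cond_exp_id hE)//.
exact: (cond_exp_in hE).
Qed.

Lemma mul_e1 t : t * e1 B E = lmul (t 1) * e1 B E.
Proof.
apply: basic_ext => x; rewrite !mul_bmap e1_bmap lmul_bmap -[in LHS](mul1r (E
  x)).
by rewrite bmapMr//; exact: (cond_exp_in hE).
Qed.

Lemma e1_lmul_e1 a : e1 B E * lmul a * e1 B E = lmul (E a) * e1 B E.
Proof. by rewrite mul_e1 mul_bmap e1_bmap lmul_bmap mulr1. Qed.

(** Right B-linearity moves t inside the quasi-basis expansion of its argument. The case t = 1 says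
    that the l e_1 l^* add up to 1. *)
Lemma basic_decomp t : t = \sum_(l <- lam) lmul (t l) * e1 B E * lmul (star l).
Proof.
apply: basic_ext => x; rewrite sum_bmap [in LHS](lam_basis x) bmap_sum.
apply: eq_bigr => l _; rewrite !mul_bmap e1_bmap !lmul_bmap bmapMr//.
exact: (cond_exp_in hE).
Qed.

(** An operator commuting with left multiplications is right multiplication by t(1), and right
    B-linearity puts t(1) in the commutant of B. This lets the results on e_1 be reused one floor up
    for e_2. *)
Lemma irreducible_lmul : irreducible B -> irreducible (range (lmul : A -> A1)).
Proof.
move=> irr; apply/seteqP; split=> [t tc|_ [c _ <-] b _]; last first.
  by rewrite -scalerAl -scalerAr mul1r mulr1.
have tx x : t x = x * t 1.
  have /(congr1 (fun s : A1 => s 1)) := tc (lmul x) (ex_intro2 _ _ x I erefl).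
  by rewrite !mul_bmap !lmul_bmap mulr1.
have : commutant B (t 1) by move=> b Bb; rewrite -tx -bmapMr// mul1r.
rewrite irr => -[c _ tc1]; exists c => //; apply: basic_ext => x.
by rewrite tx -tc1 -scalerAr mulr1.
Qed.

Context (E1 : {linear A1 -> A1}).
Hypotheses (irr : irreducible B) (hE1 : cond_exp (range lmul) E1).

Lemma E1_lmulMl a t : E1 (lmul a * t) = lmul a * E1 t.
Proof. by apply: (cond_expMl range_lmul1 hE1); exists a. Qed.

Lemma E1_lmulMr a t : E1 (t * lmul a) = E1 t * lmul a.
Proof. by apply: (cond_expMr range_lmul1 hE1); exists a. Qed.

Lemma E1_in t : E1 t = lmul (E1 t 1).
Proof.
have [a _ aE] : range lmul (E1 t) := cond_exp_in hE1 t.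
by rewrite -aE lmul_bmap mulr1.
Qed.

(* E1 e1 commutes with B, and 1 = \sum l e1 l^*. *)
Lemma E1_e1_ex : exists tau : R[i],
  E1 (e1 B E) = tau%:A /\ tau *: \sum_(l <- lam) l * star l = 1.
Proof.
have : commutant B (E1 (e1 B E) 1).
  move=> b Bb; apply: lmul_inj.
  rewrite !lmulM -E1_in -E1_lmulMl -E1_lmulMr; congr (E1 _).
  by apply: basic_ext => x; rewrite !mul_bmap e1_bmap !lmul_bmap (cond_expMl
    B1 hE).
rewrite irr => -[tau _ tauE]; exists tau.
have e1E : E1 (e1 B E) = tau%:A by rewrite E1_in -tauE lmulZ lmul1.
split=> //; apply: lmul_inj; rewrite lmul1 -[RHS](cond_exp_id hE1 range_lmul1).
rewrite [in RHS](basic_decomp 1) [RHS]linear_sum lmulZ lmul_sum scaler_sumr.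
apply: eq_bigr => l _; rewrite E1_lmulMr E1_lmulMl e1E -scalerAr mulr1.
by rewrite lmulM -scalerAl.
Qed.

Context (tau : R[i]).
Hypothesis E1e1 : E1 (e1 B E) = tau%:A.

Lemma E1_mul_e1 t : E1 (t * e1 B E) = tau *: lmul (t 1).
Proof. by rewrite mul_e1 E1_lmulMl E1e1 -scalerAr mulr1. Qed.

Lemma E1_e1_mul t : E1 (e1 B E * t) = Num.conj tau *: lmul (star (star t 1)).
Proof.
rewrite -[t in LHS]starK -[e1 B E in LHS]e1_star -starM.
by rewrite (cond_exp_star range_lmul1 hE1) E1_mul_e1 starZ lmul_star.
Qed.

Lemma E1_lmul_e1_lmul a b : E1 (lmul a * e1 B E * lmul b) = tau *: lmul (a * b).
Proof.
by rewrite E1_lmulMr E1_lmulMl E1e1 -scalerAr mulr1 -scalerAl lmulM.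
Qed.

(** This makes the results on B, A and A_1 available for A, A_1 and A_2. The condition on [k]
    cancels the factor tau of [E1_e1_mul]; the value used later is [delta]. *)
Lemma E1_quasi_basis (k : R[i]) :
  Num.conj tau = tau -> k * (Num.conj k * tau) = 1 ->
  quasi_basis E1 [seq k *: (lmul l * e1 B E) | l <- lam].
Proof.
move=> ctau ktau t; rewrite big_map; apply: basic_ext => x.
rewrite sum_bmap [LHS](lam_basis (t x)); apply: eq_bigr => l _.
have -> : k *: (lmul l * e1 B E) * E1 (star (k *: (lmul l * e1 B E)) * t) =
    lmul l * e1 B E * lmul (star (star t l)).
  rewrite starZ starM e1_star lmul_star -[_ *: _ * t]scalerAl -(mulrA (e1 B E)).
  rewrite [E1 _]linearZ/= E1_e1_mul ctau -scalerAr -scalerAl -scalerAr !scalerA.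
  by rewrite -mulrA mulrCA ktau scale1r starM lmul_star starK mul_bmap
    lmul_bmap mulr1.
by rewrite !mul_bmap !lmul_bmap e1_bmap (bstarP t l x).1.
Qed.

End BasicTheory.

(** * The Fourier transform *)

Section Index.
Context (R : realType) (A : cstarAlgType R) (B : set A) (E : {linear A -> A}).
Local Notation A1 := (basic B E).
Context (E1 : {linear A1 -> A1}) (lam : seq A).
Hypotheses (B1 : B 1) (irr : irreducible B) (hE : cond_exp B E).
Hypotheses (lam_basis : quasi_basis E lam) (hE1 : cond_exp (range lmul) E1).

(* With E1 (T^* T) = Y^* Y and v = Y 1, the scalar is E (v^* v). *)
Lemma E1_scalar_ge0 (T : A1) (k : R[i]) : E1 (star T * T) = k%:A -> 0 <= k.
Proof.
have [_ _ _ /(_ T) [Y ->]] := hE1 => Yk.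
have [_ _ _ /(_ (Y 1)) [w Ew]] := hE.
apply: (@star_mul_scalar_ge0 _ _ w); rewrite -Ew -(bstarP Y 1 (Y 1)).2.
rewrite star1 mul1r -(cond_exp_scalar B1 hE); congr (E _).
have -> : bstar Y (Y 1) = (star Y * Y) 1 by [].
by rewrite Yk.
Qed.

(** The scalar E_1(e_1) is defined without a quasi-basis, yet inverts the sum of l l^* for every one
    of them; the index is therefore well defined and is its inverse. Positivity is that of E_1(e_1^*
    e_1). *)
Lemma windexP : 0 < windex E /\ E1 (e1 B E) = ((windex E)^-1)%:C%:A.
Proof.
have [tau [e1E tau1]] := E1_e1_ex B1 hE lam_basis irr hE1.
have tau_eq mu : quasi_basis E mu -> tau *: \sum_(l <- mu) l * star l = 1.
  move=> mu_basis; have [tau' [e1E' <-]] := E1_e1_ex B1 hE mu_basis irr hE1.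
  by rewrite e1E in e1E'; rewrite (scalar_inj e1E').
have tau_neq0 : tau != 0.
  apply/eqP => tau0; move/eqP: tau1; rewrite tau0 scale0r eq_sym oner_eq0//.
have tau_gt0 : 0 < tau.
  rewrite lt_def tau_neq0/=; apply: (@E1_scalar_ge0 (e1 B E)).
  by rewrite (e1_star B1 hE lam_basis) (e1_idem B1 hE lam_basis).
have /complex_realP [t tE] : tau \is Num.real by exact: gtr0_real.
have t_gt0 : 0 < t by move: tau_gt0; rewrite tE ltcR.
have -> : windex E = t^-1.
  have idx mu : quasi_basis E mu -> \sum_(l <- mu) l * star l = (t^-1)%:C%:A.
    move=> /tau_eq h; apply: (scalerI tau_neq0);
      rewrite h scalerA tE -rmorphM/=.
    by rewrite divff ?gt_eqF// scale1r.
  rewrite /windex; case: xgetP => [r _ [mu mu_basis]|/(_ t^-1)].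
    by rewrite (idx _ mu_basis) => /scalar_inj/complexI.
  by case; exists lam; rewrite ?idx.
by rewrite invr_gt0 t_gt0 invrK -tE.
Qed.

Lemma delta_gt0 : 0 < delta E.
Proof. by rewrite sqrtr_gt0; have [] := windexP. Qed.

Lemma delta_sqr : delta E ^+ 2 = windex E.
Proof. by rewrite sqr_sqrtr// ltW//; have [] := windexP. Qed.

Lemma E1_e1 : E1 (e1 B E) = ((delta E)^-2)%:C%:A.
Proof. by rewrite delta_sqr; have [] := windexP. Qed.

Local Notation A2 := (basic (range (lmul : A -> A1)) E1).
Local Notation d := (delta E).

Let E1_basis :
  quasi_basis E1 [seq d%:C *: (lmul l * e1 B E) | l <- lam].
Proof.
apply: (E1_quasi_basis B1 hE lam_basis hE1 E1_e1); rewrite !conj_real//.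
by rewrite -!rmorphM/= mulrA -expr2 divff// expf_neq0// gt_eqF ?delta_gt0.
Qed.

Let r1 := range_lmul1 B1 hE lam_basis.

Lemma sum_lmul_e1 : \sum_(l <- lam) lmul l * e1 B E * lmul (star l) = 1.
Proof. by rewrite [RHS](basic_decomp B1 hE lam_basis). Qed.

(** The index does not change one floor up: the quasi-basis delta l e_1 of E_1 has index delta^2
    times the sum of l e_1 l^*, that is delta^2. *)
Lemma E2_e2 (E2 : {linear A2 -> A2}) : cond_exp (range lmul) E2 ->
  E2 (e2 E1) = (d^-2)%:C%:A.
Proof.
move=> hE2.
have irr1 := irreducible_lmul B1 hE lam_basis irr.
have [tau [-> ]] := E1_e1_ex r1 hE1 E1_basis irr1 hE2.
rewrite big_map.
have -> : \sum_(l <- lam)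
    d%:C *: (lmul l * e1 B E) * star (d%:C *: (lmul l * e1 B E)) =
    (d ^+ 2)%:C%:A.
  rewrite -sum_lmul_e1 scaler_sumr; apply: eq_bigr => l _.
  rewrite starZ conj_real starM (e1_star B1 hE lam_basis).
  rewrite (lmul_star B1 hE lam_basis) -scalerAl -scalerAr scalerA -rmorphM
    -expr2.
  congr (_ *: _).
  suff : lmul l * e1 B E * (e1 B E * lmul (star l)) =
    lmul l * e1 B E * lmul (star l) by [].
  by rewrite mulrA -(mulrA (lmul l)) (e1_idem B1 hE lam_basis).
rewrite scalerA -[RHS]scale1r => /scalar_inj td; congr (_ *: _).
apply: (@mulIf _ (d ^+ 2)%:C).
  by rewrite gt_eqF// ltcR exprn_gt0// delta_gt0.
by rewrite td -rmorphM/= mulVf// expf_neq0// gt_eqF// delta_gt0.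
Qed.

(** A_1 is spanned by the a e_1 b, and maps in A_2 are right A-linear. *)
Lemma basic2_ext (s t : A2) :
  (forall a, s (lmul a * e1 B E) = t (lmul a * e1 B E)) -> s = t.
Proof.
move=> st; apply: (basic_ext r1 hE1 E1_basis) => T.
rewrite [T](basic_decomp B1 hE lam_basis) !bmap_sum; apply: eq_bigr => l _.
have sl : range (lmul : A -> A1) (lmul (star l)) by exists (star l).
by rewrite !(bmapMr _ _ sl) st.
Qed.

Lemma fourier_sum (x : A1) : fourier E1 lam x = d%:C *: \sum_(l <- lam)
  lmul (lmul l) * (lmul x * e2 E1 * lmul (e1 B E)) * star (lmul (lmul l)).
Proof.
rewrite /fourier /commutant_exp scalerA -rmorphM/= -delta_sqr.
by rewrite exprSr mulrAC divff ?mul1r// expf_neq0 ?gt_eqF ?delta_gt0.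
Qed.

Lemma fourierE (x T : A1) : fourier E1 lam x T =
  d%:C *: \sum_(l <- lam) lmul l * (x * E1 (e1 B E * (lmul (star l) * T))).
Proof.
rewrite fourier_sum scale_bmap sum_bmap; congr (_ *: _); apply: eq_bigr => l _.
rewrite (lmul_star r1 hE1 E1_basis) (lmul_star B1 hE lam_basis).
by rewrite !mul_bmap !lmul_bmap (e1_bmap r1 hE1).
Qed.

Lemma star_fourierE (x T : A1) : star (fourier E1 lam x) T =
  d%:C *: \sum_(l <- lam) lmul l * (e1 B E * E1 (star x * (lmul (star l) * T))).
Proof.
rewrite fourier_sum starZ conj_real star_sum scale_bmap sum_bmap;
  congr (_ *: _).
apply: eq_bigr => l _; rewrite !starM starK.
rewrite !(lmul_star r1 hE1 E1_basis) (lmul_star B1 hE lam_basis).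
rewrite (e1_star r1 hE1 E1_basis) (e1_star B1 hE lam_basis).
by rewrite !mul_bmap !lmul_bmap (e1_bmap r1 hE1).
Qed.

(* Identifying A_1 with the balanced tensor square of A over B, the map
   fourier x sends a e1 b to delta^-1 a x b. *)
Lemma fourier_lmul_e1 (x : A1) a : (forall b, B b -> x * lmul b = lmul b * x) ->
  fourier E1 lam x (lmul a * e1 B E) = (d^-1)%:C *: (lmul a * x).
Proof.
move=> xB; rewrite fourierE.
have -> : \sum_(l <- lam) lmul l * (x * E1 (e1 B E * (lmul (star l) * (lmul a
  * e1 B E))))
   = (d^-2)%:C *: (lmul a * x).
  rewrite [a in RHS](lam_basis a) (lmul_sum B1 hE lam_basis) mulr_suml
    scaler_sumr.
  apply: eq_bigr => l _; rewrite !(mulrA _ _ (e1 B E)) -(lmulM B1 hE lam_basis).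
  rewrite (e1_lmul_e1 B1 hE lam_basis).
  rewrite (E1_lmulMl B1 hE lam_basis hE1) E1_e1 -!scalerAr mulr1.
  rewrite xB ?mulrA ?(lmulM B1 hE lam_basis)//; exact: (cond_exp_in hE).
rewrite scalerA -rmorphM/= expr2 invfM mulrA divff ?mul1r// gt_eqF//.
exact: delta_gt0.
Qed.

(** The second hypothesis says that x^* is the transpose of x for the bilinear form E(a y), with no
    star on a. At y, the adjoint sends a e_1 to delta^-1 times the sum of l E(x^*(l^* a) y);
    transposing turns this into the quasi-basis expansion of a x(y). *)
Lemma fourier_self_adj (x : A1) : (forall b, B b -> x * lmul b = lmul b * x) ->
  (forall a y, E (star x a * y) = E (a * x y)) ->
  star (fourier E1 lam x) = fourier E1 lam x.
Proof.
move=> xB xsym; apply: basic2_ext => a.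
rewrite fourier_lmul_e1// star_fourierE.
apply: (basic_ext B1 hE lam_basis) => y.
rewrite !scale_bmap sum_bmap mul_bmap lmul_bmap [a * x y]lam_basis.
have -> : \sum_(l <- lam) (lmul l * (e1 B E * E1 (star x * (lmul (star l) *
  (lmul a * e1 B E))))) y
   = (d^-2)%:C *: \sum_(l <- lam) l * E (star l * (a * x y)).
  rewrite scaler_sumr; apply: eq_bigr => l _.
  rewrite !(mulrA _ _ (e1 B E)) (E1_mul_e1 B1 hE lam_basis hE1 E1_e1).
  rewrite -!scalerAr scale_bmap !mul_bmap (e1_bmap B1 hE) !lmul_bmap.
  by rewrite mulr1 xsym mulrA.
rewrite scalerA -rmorphM/= expr2 invfM mulrA divff ?mul1r// gt_eqF//.
exact: delta_gt0.
Qed.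

(** Since x e_1 = e_1, each summand of [fourier_sum] is mapped to delta^-2 l e_1 l^*, and the l e_1
    l^* add up to 1. *)
Lemma E2_fourier (E2 : {linear A2 -> A2}) (x : A1) :
  cond_exp (range lmul) E2 -> x * e1 B E = e1 B E ->
  E2 (fourier E1 lam x) = (d^-1)%:C%:A.
Proof.
move=> hE2 xe1; have e2E := E2_e2 hE2.
rewrite fourier_sum linearZ/= linear_sum.
have -> : \sum_(l <- lam) E2 (lmul (lmul l) * (lmul x * e2 E1 * lmul (e1 B E)) *
    star (lmul (lmul l))) = (d^-2)%:C%:A.
  rewrite -(lmul1 r1 hE1 E1_basis) -sum_lmul_e1 (lmul_sum r1 hE1 E1_basis)
    scaler_sumr.
  apply: eq_bigr => l _.
  rewrite (lmul_star r1 hE1 E1_basis) (lmul_star B1 hE lam_basis).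
  rewrite !mulrA -(lmulM r1 hE1 E1_basis) -!(mulrA _ (lmul (e1 B E))).
  rewrite -(lmulM r1 hE1 E1_basis).
  rewrite (E1_lmul_e1_lmul r1 hE1 E1_basis hE2 e2E).
  by rewrite -(mulrA (lmul l) x) (mulrA x) xe1 mulrA.
rewrite scalerA -rmorphM/= expr2 invfM mulrA divff ?mul1r// gt_eqF//.
exact: delta_gt0.
Qed.

End Index.

(** * The angle operator *)

Lemma cond_exp_comp (R : realType) (A : starAlgType R[i]) (B C : set A)
    (E F : {linear A -> A}) :
  B `<=` C -> cond_exp B E -> cond_exp C F -> cond_exp B (E \o F).
Proof.
move=> BC [Ein Eid Ebi Epos] [Fin Fid Fbi Fpos];
  split=> [x|b Bb|b x b' Bb Bb'|x].
- exact: Ein.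
- by rewrite /= Fid ?Eid//; exact: BC.
- by rewrite /= Fbi ?Ebi//; exact: BC.
- by have [y /= ->] := Fpos x; exact: Epos.
Qed.

Section AngleOperator.
Context (R : realType) (A : cstarAlgType R) (B C D : set A) (E EC ED :
  {linear A -> A}).
Local Notation A1 := (basic B E).
Context (E1 : {linear A1 -> A1}) (lam : seq A).
Hypotheses (B1 : B 1) (irr : irreducible B) (hE : cond_exp B E).
Hypotheses (lam_basis : quasi_basis E lam) (hE1 : cond_exp (range lmul) E1).
Hypotheses (BC : B `<=` C) (BD : B `<=` D).
Hypotheses (hC : cond_exp C EC) (hD : cond_exp D ED).
Hypotheses (D_mul : forall x y, D x -> D y -> D (x * y)).
Hypotheses (D_star : forall x, D x -> D (star x)).
Local Notation d := (delta E).

Let C1 : C 1 := BC B1.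
Let D1 : D 1 := BD B1.

(** E F is again an expectation onto B, and irreducibility leaves only one. *)
Lemma cond_exp_sub (C' : set A) (F : {linear A -> A}) :
  B `<=` C' -> cond_exp C' F -> forall x, E (F x) = E x.
Proof.
move=> BC' hF.
exact: (cond_exp_unique B1 hE lam_basis irr (cond_exp_comp BC' hE hF)).
Qed.

Let EEC := cond_exp_sub BC hC.
Let EED := cond_exp_sub BD hD.

Local Notation eC := (as_basic EC : A1).
Local Notation eD := (as_basic ED : A1).
Local Notation Theta := (eC * eD).

Lemma eC_bmap : bmap eC = EC.
Proof. exact: (cond_exp_as_basic C1 BC hC EEC). Qed.

Lemma eD_bmap : bmap eD = ED.
Proof. exact: (cond_exp_as_basic D1 BD hD EED). Qed.

Lemma eC_star : star eC = eC.
Proof.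
apply: (basic_self_adj B1 hE lam_basis) => x y; rewrite eC_bmap.
by rewrite -EEC -[RHS]EEC (cond_exp_sym C1 hC).
Qed.

Lemma eD_star : star eD = eD.
Proof.
apply: (basic_self_adj B1 hE lam_basis) => x y; rewrite eD_bmap.
by rewrite -EED -[RHS]EED (cond_exp_sym D1 hD).
Qed.

Lemma angle_bmap x : Theta x = EC (ED x).
Proof. by rewrite mul_bmap eC_bmap eD_bmap. Qed.

Lemma angle_star_bmap x : star Theta x = ED (EC x).
Proof. by rewrite starM eC_star eD_star mul_bmap eC_bmap eD_bmap. Qed.

Lemma angle_e1 : Theta * e1 B E = e1 B E.
Proof.
apply: (basic_ext B1 hE lam_basis) => x.
rewrite !mul_bmap (e1_bmap B1 hE) eC_bmap eD_bmap (cond_exp_id hD).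
  by rewrite (cond_exp_id hC)//; apply/BC/(cond_exp_in hE).
exact/BD/(cond_exp_in hE).
Qed.

Lemma angle_star_e1 : star Theta * e1 B E = e1 B E.
Proof.
apply: (basic_ext B1 hE lam_basis) => x.
rewrite mul_bmap (e1_bmap B1 hE) angle_star_bmap (cond_exp_id hC).
  by rewrite (cond_exp_id hD)//; apply/BD/(cond_exp_in hE).
exact/BC/(cond_exp_in hE).
Qed.

Lemma angle_comm b : B b -> Theta * lmul b = lmul b * Theta.
Proof.
move=> Bb; apply: (basic_ext B1 hE lam_basis) => x.
rewrite mul_bmap angle_bmap mul_bmap !lmul_bmap angle_bmap.
by rewrite (cond_expMl D1 hD _ (BD Bb)) (cond_expMl C1 hC _ (BC Bb)).
Qed.

(** E_C and E_D are symmetric for the bilinear form E(a y), so transposing Theta reverses the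
    product just as the adjoint does. *)
Lemma angle_sym a y : E (star Theta a * y) = E (a * Theta y).
Proof.
rewrite angle_star_bmap angle_bmap.
by rewrite -EED (cond_exp_adj D1 hD) EED -EEC (cond_exp_adj C1 hC) EEC.
Qed.

Local Notation nu l := (ED l).

Lemma ED_sum x : ED x = \sum_(l <- lam) nu l * E (star (nu l) * x).
Proof.
rewrite -[LHS](cond_exp_id hD (cond_exp_in hD _)) [in LHS](lam_basis (ED x)).
rewrite linear_sum; apply: eq_bigr => l _.
rewrite /= (cond_expMr D1 hD); last exact/BD/(cond_exp_in hE).
by rewrite -[X in _ * X]EED -(cond_exp_sym D1 hD) EED.
Qed.

Lemma ED_sumr x : ED x = \sum_(l <- lam) E (x * nu l) * star (nu l).
Proof.
rewrite -[LHS]starK -(cond_exp_star D1 hD) ED_sum star_sum.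
apply: eq_bigr => l _.
by rewrite starM -(cond_exp_star B1 hE) starM !starK.
Qed.

(** The operator that appears when F(Theta) is squared; on D it reduces to multiplication by kappa =
    [twist 1]. *)
Definition twist x := \sum_(l <- lam) nu l * EC (star (nu l) * x).

(** Expand x nu_k over the nu_l, exchange the sums and refold nu_l^* x over the nu_k^*. The
    coefficients E(nu_l^* x nu_k) lie in B, hence in C, and pass through E_C. *)
Lemma twist_mul x : D x -> twist x = x * twist 1.
Proof.
move=> Dx; apply/esym.
have xnu k : x * nu k = \sum_(l <- lam) nu l * E (star (nu l) * (x * nu k)).
  by rewrite -ED_sum [RHS](cond_exp_id hD)//; apply: D_mul => //;
    exact: (cond_exp_in hD).
rewrite /twist mulr_sumr.
under eq_bigr do rewrite mulrA xnu mulr_suml.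
rewrite exchange_big/=; apply: eq_bigr => l _.
have -> : star (nu l) * x = ED (star (nu l) * x).
  by rewrite [RHS](cond_exp_id hD)//; apply: D_mul => //;
    apply/D_star/(cond_exp_in hD).
rewrite [ED (_ * x)]ED_sumr linear_sum mulr_sumr; apply: eq_bigr => k _.
rewrite -mulrA; congr (_ * _).
rewrite mulr1 /= (cond_expMl C1 hC); last exact/BC/(cond_exp_in hE).
by rewrite !mulrA.
Qed.

Lemma twist_scalar : exists kappa : R[i], twist 1 = kappa%:A.
Proof.
suff : commutant B (twist 1) by rewrite irr => -[kappa _ <-]; exists kappa.
move=> b Bb; rewrite -twist_mul; last exact: BD.
rewrite /twist mulr_suml; apply: eq_bigr => l _.
by rewrite mulr1 (cond_expMr C1 hC _ (BC Bb)) mulrA.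
Qed.

Lemma angle_sum :
  Theta = \sum_(l <- lam) lmul (EC (nu l)) * e1 B E * lmul (star (nu l)).
Proof.
apply: (basic_ext B1 hE lam_basis) => x.
rewrite sum_bmap angle_bmap ED_sum linear_sum; apply: eq_bigr => l _.
rewrite !mul_bmap (e1_bmap B1 hE) !lmul_bmap.
rewrite /= (cond_expMr C1 hC)//; exact/BC/(cond_exp_in hE).
Qed.

Lemma angle_star_angle_sum : star Theta * Theta =
  \sum_(l <- lam) lmul (ED (EC (nu l))) * e1 B E * lmul (star (nu l)).
Proof.
rewrite [X in _ * X]angle_sum mulr_sumr; apply: eq_bigr => l _.
rewrite !mulrA; congr (_ * _); apply: (basic_ext B1 hE lam_basis) => x.
rewrite !mul_bmap angle_star_bmap (e1_bmap B1 hE) !lmul_bmap.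
have BEx := cond_exp_in hE x.
rewrite (cond_expMr C1 hC _ (BC BEx)) (cond_expMr D1 hD _ (BD BEx)).
by rewrite (cond_exp_id hC)//; exact: (cond_exp_in hC).
Qed.

Lemma sum_EC_nu (kappa : R[i]) : twist 1 = kappa%:A ->
  \sum_(l <- lam) EC (nu l) * star (nu l) = (Num.conj kappa)%:A.
Proof.
move=> twist1; rewrite -star_scalar -twist1 star_sum; apply: eq_bigr => l _.
by rewrite starM -(cond_exp_star C1 hC) mulr1 starK.
Qed.

Let e1E : E1 (e1 B E) = (d ^- 2)%:C%:A := E1_e1 B1 irr hE lam_basis hE1.
Let d_gt0 : 0 < d := delta_gt0 B1 irr hE lam_basis hE1.

Lemma E1_angle (kappa : R[i]) : twist 1 = kappa%:A ->
  E1 Theta = ((d ^- 2)%:C * Num.conj kappa)%:A.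
Proof.
move=> twist1; rewrite angle_sum linear_sum/=.
under eq_bigr do rewrite (E1_lmul_e1_lmul B1 hE lam_basis hE1 e1E).
rewrite -scaler_sumr -(lmul_sum B1 hE lam_basis) (sum_EC_nu twist1).
by rewrite (lmulZ B1 hE lam_basis) (lmul1 B1 hE lam_basis) scalerA.
Qed.

(** The value agrees with that of [E1_angle]: the nu_l^* lie in D, so the extra E_D acts on the
    whole sum of [sum_EC_nu], which is a scalar. *)
Lemma E1_angle_star_angle (kappa : R[i]) : twist 1 = kappa%:A ->
  E1 (star Theta * Theta) = ((d ^- 2)%:C * Num.conj kappa)%:A.
Proof.
move=> twist1; rewrite angle_star_angle_sum linear_sum/=.
under eq_bigr do rewrite (E1_lmul_e1_lmul B1 hE lam_basis hE1 e1E).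
rewrite -scaler_sumr -(lmul_sum B1 hE lam_basis).
have -> : \sum_(l <- lam) ED (EC (nu l)) * star (nu l) = (Num.conj kappa)%:A.
  rewrite -(cond_exp_scalar D1 hD) -(sum_EC_nu twist1) linear_sum.
  apply: eq_bigr => l _; rewrite /= (cond_expMr D1 hD)//.
  exact/D_star/(cond_exp_in hD).
by rewrite (lmulZ B1 hE lam_basis) (lmul1 B1 hE lam_basis) scalerA.
Qed.

(* E1 is positive on (Theta - e1)^* (Theta - e1) = Theta^* Theta - e1. *)
Lemma twist_ge1 (kappa : R[i]) : twist 1 = kappa%:A -> 1 <= kappa.
Proof.
move=> twist1.
have e1T : e1 B E * Theta = e1 B E.
  by rewrite -[LHS]starK starM (e1_star B1 hE lam_basis) angle_star_e1
    (e1_star B1 hE lam_basis).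
have : 0 <= (d ^- 2)%:C * Num.conj kappa - (d ^- 2)%:C.
  apply: (E1_scalar_ge0 B1 hE hE1 (T := Theta - e1 B E)).
  rewrite starB (e1_star B1 hE lam_basis) mulrBl !mulrBr angle_star_e1 e1T.
  rewrite (e1_idem B1 hE lam_basis) subrr subr0 linearB/=.
  by rewrite (E1_angle_star_angle twist1) e1E scalerBl.
rewrite -{2}[(d ^- 2)%:C]mulr1 -mulrBr pmulr_rge0; last first.
  by rewrite ltcR invr_gt0 exprn_gt0.
(* The bound 1 <= conj kappa makes conj kappa real, hence equal to kappa. *)
rewrite subr_ge0 => k1; rewrite -[kappa]conjCK conj_Creal//.
by rewrite ger0_real// (le_trans ler01).
Qed.

Lemma fourier_angle_sqr (kappa : R[i]) : twist 1 = kappa%:A ->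
  fourier E1 lam Theta * fourier E1 lam Theta =
  ((d^-1)%:C * kappa) *: fourier E1 lam Theta.
Proof.
move=> twist1; apply: (basic2_ext B1 irr hE lam_basis hE1) => a.
have FE b : fourier E1 lam Theta (lmul b * e1 B E) =
  (d^-1)%:C *: (lmul b * Theta).
  exact: (fourier_lmul_e1 B1 irr hE lam_basis hE1 _ angle_comm).
move: (fourier E1 lam Theta) FE => G FE.
rewrite mul_bmap scale_bmap !FE bmapZ -scalerA; congr (_ *: _).
(* Only the inner Theta is expanded: F(Theta) then meets terms a E_C(nu_l) e_1 nu_l^*, where right
   A-linearity and [FE] apply, and the sum becomes [twist] at E_D(y). *)
rewrite [in LHS]angle_sum mulr_sumr bmap_sum.
apply: (basic_ext B1 hE lam_basis) => y.
rewrite sum_bmap !scale_bmap mul_bmap lmul_bmap angle_bmap.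
have -> : \sum_(l <- lam) G (lmul a * (lmul (EC (nu l)) * e1 B E * lmul (star
  (nu l)))) y
   = (d^-1)%:C *: (a * EC (twist (ED y))).
  rewrite /twist linear_sum mulr_sumr scaler_sumr; apply: eq_bigr => l _.
  have rl : range (lmul : A -> A1) (lmul (star (nu l))) by exists (star (nu l)).
  rewrite !mulrA -(lmulM B1 hE lam_basis) (bmapMr _ _ rl) FE.
  rewrite mul_bmap scale_bmap mul_bmap !lmul_bmap angle_bmap; congr (_ *: _).
  rewrite (cond_expMl D1 hD); last exact/D_star/(cond_exp_in hD).
  rewrite -mulrA; congr (_ * _).
  by rewrite [RHS](cond_expMr C1 hC)//; exact: (cond_exp_in hC).
rewrite twist_mul; last exact: (cond_exp_in hD).
by rewrite twist1 -scalerAr mulr1 linearZ/= -scalerAr !scalerA mulrC.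
Qed.

End AngleOperator.

(** * From the spectral form of F(Theta) to its entropy *)

Lemma scalar_of_scalar (R : realType) (A : starAlgType R[i]) (c : R[i]) :
  scalar_of (c%:A : A) = c.
Proof.
rewrite /scalar_of; case: xgetP => [e _ /scalar_inj //|/(_ c)].
by move=> /(_ erefl).
Qed.

Lemma eta_log_sqr (R : realType) (s : R) : 0 < s ->
  eta_log (s ^+ 2) = 2 * s * eta_log s.
Proof. by move=> s0; rewrite /eta_log lnXn// mulr2n expr2; ring. Qed.

Theorem theoremA (R : realType) (A : cstarAlgType R) (B C D : set A)
  (A_simple : simple [set: A])
  (B_sub : cstar_subalg B) (B_simple : simple B)
  (B_irreducible : irreducible B)
  (B_finite : exists F : {linear A -> A}, cond_exp B F /\ index_finite F)
  (C_sub : cstar_subalg C) (C_simple : simple C) (BC : B `<=` C)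
  (D_sub : cstar_subalg D) (D_simple : simple D) (BD : B `<=` D)
  (E : {linear A -> A}) (E_min : minimal_exp B E)
  (EC : {linear A -> A}) (EC_min : minimal_exp C EC)
  (ED : {linear A -> A}) (ED_min : minimal_exp D ED)
  (E1 : {linear basic B E -> basic B E})
  (E1_min : minimal_exp (range lmul) E1)
  (E2 : {linear basic (range lmul) E1 -> basic (range lmul) E1})
  (E2_min : minimal_exp (range lmul) E2)
  (lam : seq A) (lam_basis : quasi_basis E lam) :
  let Theta : basic B E := as_basic EC * as_basic ED in
  let FTheta := fourier E1 lam Theta in
  exists t : R, tr1 E1 Theta = t%:C /\
    entropy (tr2 E2) (star FTheta * FTheta) =
      (2 / Num.sqrt (windex E) * eta_log (delta E * t))%:C.
Proof.
move=> Theta FTheta.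
have [B1 _ _ _ _] := B_sub; have [_ _ D_mul D_star _] := D_sub.
have [hE _ _] := E_min; have [hC _ _] := EC_min; have [hD _ _] := ED_min.
have [hE1 _ _] := E1_min; have [hE2 _ _] := E2_min.
have r1 := range_lmul1 B1 hE lam_basis.
have d_gt0 := delta_gt0 B1 B_irreducible hE lam_basis hE1.
pose d := delta E; have d_neq0 : d != 0 by rewrite gt_eqF.
have [kappa twist1] := twist_scalar B1 B_irreducible hE lam_basis BC BD hC hD
  D_mul D_star.
have kappa_ge1 := twist_ge1 B1 B_irreducible hE lam_basis hE1 BC BD hC hD
  D_star twist1.
have /complex_realP [k kE] : kappa \is Num.real.
  by rewrite ger0_real// (le_trans ler01).
have k_gt0 : 0 < k.
  by rewrite -ltcR -kE (lt_le_trans _ kappa_ge1)// ltr01.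
(* The eigenvalue of F(Theta) on its range projection, equal to delta tr(Theta). *)
pose s := d^-1 * k; have s_gt0 : 0 < s by rewrite mulr_gt0 ?invr_gt0.
have s_neq0 : s != 0 by rewrite gt_eqF.
exists (d ^- 2 * k); split.
  rewrite /tr1 (E1_angle B1 B_irreducible hE lam_basis hE1 BC BD hC hD twist1).
  rewrite scale_bmap (cond_exp_scalar B1 hE) scalar_of_scalar kE conj_real.
  by rewrite -rmorphM.
have G_star : star FTheta = FTheta.
  apply: (fourier_self_adj B1 B_irreducible hE lam_basis hE1).
    exact: (angle_comm B1 B_irreducible hE lam_basis BC BD hC hD).
  exact: (angle_sym B1 B_irreducible hE lam_basis BC BD hC hD).
have GG : FTheta * FTheta = s%:C *: FTheta.
  rewrite (fourier_angle_sqr B1 B_irreducible hE lam_basis hE1 BC BD hC hD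
    D_mul D_star twist1).
  by rewrite kE -rmorphM.
have E2G : E2 FTheta = (d^-1)%:C%:A.
  apply: (E2_fourier B1 B_irreducible hE lam_basis hE1 hE2).
  exact: (angle_e1 B1 B_irreducible hE lam_basis BC BD hC hD).
move: FTheta G_star GG E2G => G G_star GG E2G.
(* P = s^-1 G is a projection, so the square of the modulus of G is s^2 P. *)
have -> : star G * G = (s ^+ 2)%:C *: ((s^-1)%:C *: G).
  by rewrite G_star GG scalerA -rmorphM expr2 mulfK.
rewrite /entropy fun_calc_proj.
- have E2c (c : R) : E2 (c%:C *: G) = (c * d^-1)%:C%:A.
    by rewrite linearZ/= E2G scalerA -rmorphM.
  rewrite /tr2 /tr1 scalerA -rmorphM E2c.
  rewrite scale_bmap (cond_exp_scalar r1 hE1) scale_bmap.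
  rewrite (cond_exp_scalar B1 hE) scalar_of_scalar; congr (_%:C).
  (* It remains to combine tr(P) = 1 / (s delta) with eta(s^2) = 2 s eta(s). *)
  have -> : delta E * (d ^- 2 * k) = s by rewrite /s /d; field.
  rewrite eta_log_sqr// -/(delta E) -/d; field.
  by rewrite d_neq0 s_neq0.
- by rewrite /eta_log mul0r oppr0.
- by rewrite starZ G_star conj_real.
- rewrite -scalerAl -scalerAr GG !scalerA -!rmorphM/=; congr (_%:C *: _).
  by field.
Qed.
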